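(* Let $q$ be a power of $2$ and $n\ge1$ an integer. For $\alpha\in\mathbb{F}_q^\times$ let $C_\alpha$ be the curve over $\mathbb{F}_q$ given by $x(y^2+y)=\alpha(x^2+1)$, i.e. the projective plane cubic $xy^2+xyz=\alpha(x^2z+z^3)$, and let $S_\alpha(\mathbb{F}_{q^n})=\#C_\alpha(\mathbb{F}_{q^n})-(q^n+1)$, where $\#C_\alpha(\mathbb{F}_{q^n})$ is the number of its points in $\mathbb{P}^2(\mathbb{F}_{q^n})$. Then \[ F_q(n,0,0)=q^{n-2}+\frac{q-1}{q^2}\sum_{\alpha\in\mathbb{F}_q^\times}\left(S_\alpha(\mathbb{F}_{q^n})+1\right). \]
   Context: For $a\in\mathbb{F}_{q^n}$, $\mathrm{Tr}(a)=\sum_{i=0}^{n-1}a^{q^i}$ and $\mathrm{rTr}(a)=\sum_{i=0}^{n-1}a^{-q^i}$, with the convention $\mathrm{rTr}(0)=0$. $F_q(n,0,0)$ is the number of $a\in\mathbb{F}_{q^n}$ with $\mathrm{Tr}(a)=0$ and $\mathrm{rTr}(a)=0$. *)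

(* Defs.v *)
From HB Require Import structures.
From mathcomp Require Import all_boot all_order all_algebra.

Set Implicit Arguments.
Unset Strict Implicit.
Unset Printing Implicit Defensive.

Import GRing.Theory Num.Theory.
Local Open Scope ring_scope.

(* F_{q^n} is a finite field L with q^n elements.  Both traces are L-valued;
   they lie in the subfield F_q of L. *)
Definition Tr (L : finFieldType) (q n : nat) (a : L) : L :=
  \sum_(i < n) a ^+ (q ^ i)%N.

(* Since 0^-1 = 0 and q ^ i > 0 whenever q > 0, this gives rTr q n 0 = 0. *)
Definition rTr (L : finFieldType) (q n : nat) (a : L) : L :=
  \sum_(i < n) a ^- (q ^ i)%N.

Definition Fcount (L : finFieldType) (q n : nat) : nat :=
  #|[set a : L | (Tr q n a == 0) && (rTr q n a == 0)]|.

Definition proportional (L : finFieldType) (v w : 'rV[L]_3) : bool :=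
  [exists c : L, (c != 0) && (w == c *: v)].

(* A point of P^2(L) is the full class of its homogeneous coordinate vectors. *)
Definition proj_plane (L : finFieldType) : {set {set 'rV[L]_3}} :=
  equivalence_partition (@proportional L) [set v : 'rV[L]_3 | v != 0].

Definition on_cubic (L : finFieldType) (alpha : L) (v : 'rV[L]_3) : bool :=
  let x := v 0 (inord 0) in
  let y := v 0 (inord 1) in
  let z := v 0 (inord 2) in
  x * y ^+ 2 + x * y * z == alpha * (x ^+ 2 * z + z ^+ 3).

(* The equation is homogeneous, so it holds at all representatives of a point
   as soon as it holds at one. *)
Definition curve_points (L : finFieldType) (alpha : L) :
    {set {set 'rV[L]_3}} :=
  [set P in proj_plane L | [forall v in P, on_cubic alpha v]].

(* S_alpha(L) for alpha in F, with L an extension of F through iota. *)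
Definition S_curve (F L : finFieldType) (iota : {rmorphism F -> L}) (alpha : F) :
    int :=
  #|curve_points (iota alpha)|%:Z - (#|L|%:Z + 1).

(* Main.v *)
Require Import Defs.
From HB Require Import structures.
From mathcomp Require Import all_boot all_order all_algebra all_field.
From mathcomp Require Import ring.

(* Let chi be (-1) to the absolute trace.  By orthogonality over F_q, the
   number q^2 F_q(n,0,0) is the sum over s, t in F_q of the Kloosterman sums
   K(s, t) = sum_a chi(s a + t / a).  The terms with s t = 0 contribute q^n in
   total, and K(s, t) depends only on s t otherwise, so that the remaining terms
   are q - 1 copies of sum_beta K(1, beta) = sum_alpha K(alpha, alpha), because
   beta = alpha^2 is a permutation of F_q^*.  On the curve side, the equation
   y^2 + y = alpha (x + 1/x) has 1 + chi(alpha (x + 1/x)) solutions y, hence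
   S_alpha + 1 = K(alpha, alpha). *)

Import GRing.Theory Num.Theory.
Local Open Scope ring_scope.

(** * Traces as power sums, and the fixed field of Frobenius *)

Lemma Tr_add (K : finFieldType) (q n : nat) (a b : K) :
  [pchar K].-nat q -> Tr q n (a + b) = Tr q n a + Tr q n b.
Proof.
move=> qK; rewrite /Tr -big_split; apply: eq_bigr => i _ /=.
by rewrite exprDn_pchar // pnatX qK.
Qed.

(** Raising to the power [q] shifts the exponents by one, and the last term [a ^+ (q ^ n)] wraps
    around to [a]. *)
Lemma Tr_expq (K : finFieldType) (q n : nat) (a : K) :
  [pchar K].-nat q -> #|K| = (q ^ n)%N -> Tr q n a ^+ q = Tr q n a.
Proof.
move=> qK cardK; rewrite /Tr.
have -> : (\sum_(i < n) a ^+ (q ^ i)) ^+ q = \sum_(i < n) a ^+ (q ^ i.+1).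
  elim: n {cardK} => [|n IHn]; last first.
    rewrite !big_ord_recr /= exprDn_pchar // IHn.
    by rewrite -exprM -expnSr.
  by rewrite !big_ord0 expr0n; case: q qK.
case: n cardK => [|n] cardK; first by rewrite !big_ord0.
rewrite big_ord_recr big_ord_recl /= -cardK expf_card expn0 expr1 addrC.
by congr (_ + _); apply: eq_bigr => i _; rewrite /= /bump.
Qed.

Lemma Tr_add_length (K : finFieldType) (q m n : nat) (a : K) :
  Tr q (m + n) a = Tr q m a + Tr q n (a ^+ (q ^ m)).
Proof.
rewrite /Tr big_split_ord /=; congr (_ + _); apply: eq_bigr => i _.
by rewrite -exprM -expnD.
Qed.

(** Induction on [n] peels off the first block of [k] exponents. This links the absolute trace of
    [L] to that of [F]. *)
Lemma Tr_transitive (K : finFieldType) (p k n : nat) (a : K) :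
  [pchar K].-nat p -> Tr p (k * n) a = Tr p k (Tr (p ^ k) n a).
Proof.
move=> pK; have p_gt0 : (0 < p)%N by case/andP: pK.
elim: n a => [|n IHn] a.
  rewrite muln0 {1 3}/Tr !big_ord0 /Tr big1 // => i _.
  by rewrite expr0n expn_eq0 eqn0Ngt p_gt0.
rewrite mulnS Tr_add_length IHn -Tr_add //; congr (Tr _ _ _).
rewrite -addn1 addnC Tr_add_length expn1; congr (_ + _).
by rewrite /Tr big_ord1 expn0 expr1.
Qed.

Lemma card_Tr2_eq0 (K : finFieldType) (m : nat) :
  (0 < m)%N -> (#|[set c : K | Tr 2 m c == 0%R]| <= 2 ^ m.-1)%N.
Proof.
case: m => // m _ /=.
pose p : {poly K} := \sum_(i < m.+1) 'X^(2 ^ i).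
have size_p : size p = (2 ^ m).+1.
  rewrite /p big_ord_recr /= addrC size_polyDl size_polyXn //.
  apply: leq_ltn_trans (size_sum _ _ _) _; rewrite ltnS.
  apply/bigmax_leqP => i _; rewrite size_polyXn.
  by rewrite ltn_exp2l.
have p_neq0 : p != 0 by rewrite -size_poly_gt0 size_p.
rewrite -ltnS -size_p cardE; apply: max_poly_roots p_neq0 _ (enum_uniq _).
apply/allP => c; rewrite mem_enum inE => /eqP Tc.
rewrite rootE /p horner_sum -[X in _ == X]Tc /Tr.
by apply/eqP/eq_bigr => i _; rewrite hornerXn.
Qed.

Lemma card_expq_fixed (K : finFieldType) (q : nat) :
  (1 < q)%N -> (#|[set x : K | x ^+ q == x]%R| <= q)%N.
Proof.
move=> q_gt1; pose p : {poly K} := 'X^q - 'X.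
have size_p : size p = q.+1.
  by rewrite /p size_polyDl size_polyXn // size_polyN size_polyX ltnS.
have p_neq0 : p != 0 by rewrite -size_poly_gt0 size_p.
rewrite -ltnS -size_p cardE; apply: max_poly_roots p_neq0 _ (enum_uniq _).
apply/allP => c; rewrite mem_enum inE => /eqP xc.
by rewrite rootE !hornerE xc subrr.
Qed.

(** The image of [iota] already supplies [#|F|] roots of [X^q - X], [q = #|F|], as many as it can
    have. Relative traces thus descend to [F]. *)
Lemma expq_fixed_im (F L : finFieldType) (iota : {rmorphism F -> L}) (x : L) :
  x ^+ #|F| = x -> exists b : F, x = iota b.
Proof.
move=> xq.
have : x \in iota @: F.
  have /eqP -> : iota @: F == [set x : L | x ^+ #|F| == x].
    rewrite eqEcard (card_imset _ (fmorph_inj iota)).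
    rewrite card_expq_fixed ?finNzRing_gt1 // andbT.
    apply/subsetP => _ /imsetP[b _ ->].
    by rewrite inE -rmorphXn expf_card.
  by rewrite inE xq.
by case/imsetP => b _ ->; exists b.
Qed.

(** * The sign character and Artin-Schreier equations in characteristic 2 *)

Section QuadraticCharacter.

Variables (K : finFieldType) (m : nat).
Hypothesis cardK : #|K| = (2 ^ m)%N.

Lemma pchar2 : 2%N \in [pchar K].
Proof. by apply: (card_finPcharP cardK). Qed.

Lemma pchar2_nat k : [pchar K].-nat (2 ^ k)%N.
Proof. by rewrite pnatX pnatE ?pchar2. Qed.

Lemma absdeg_gt0 : (0 < m)%N.
Proof.
by case: m cardK => // cardK1; move: (finNzRing_gt1 K); rewrite cardK1.
Qed.

(* For [#|K| = 2 ^ m] this is [(-1)] to the absolute trace of [c]. *)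
Definition chi (c : K) : rat := if Tr 2 m c == 0 then 1 else - 1.

Lemma Tr2_cases (c : K) : Tr 2 m c = 0 \/ Tr 2 m c = 1.
Proof.
have /eqP := @Tr_expq _ _ _ c (pchar2_nat 1) cardK.
rewrite -subr_eq0 expr2 -[X in _ - X]mulr1 -mulrBr mulf_eq0 subr_eq0.
by case/orP => /eqP; [left | right].
Qed.

Lemma chiD a b : chi (a + b) = chi a * chi b.
Proof.
rewrite /chi Tr_add ?(pchar2_nat 1) //.
case: (Tr2_cases a) => ->; case: (Tr2_cases b) => ->;
  by rewrite ?addr0 ?add0r ?addrr_pchar2 ?pchar2 // ?eqxx ?oner_eq0
             ?mulr1 ?mul1r ?mulrNN ?mulr1.
Qed.

Lemma chi0 : chi 0 = 1.
Proof.
rewrite /chi /Tr big1 ?eqxx // => i _.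
by rewrite expr0n expn_eq0.
Qed.

Lemma artin_schreier_fiber (y z : K) :
  (z ^+ 2 + z == y ^+ 2 + y) = (z \in [set y; y + 1]).
Proof.
rewrite !inE -subr_eq0 -(subr_eq0 z y) -(subr_eq0 z (y + 1)).
(* An identity in every commutative ring; the correction [y + y + 1 + 1] vanishes in characteristic
   2. *)
have -> : z ^+ 2 + z - (y ^+ 2 + y) = (z - y) * (z - (y + 1) + (y + y + 1 + 1)).
  by ring.
rewrite !addrr_pchar2 ?pchar2 // add0r addrr_pchar2 ?pchar2 // addr0.
by rewrite mulf_eq0.
Qed.

Lemma Tr2_artin_schreier (y : K) : Tr 2 m (y ^+ 2 + y) = 0.
Proof.
rewrite Tr_add ?(pchar2_nat 1) //.
suff -> : Tr 2 m (y ^+ 2) = Tr 2 m y by rewrite addrr_pchar2 ?pchar2.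
(* The trace of [y] is its own square, and squaring distributes over the sum. *)
rewrite -[RHS](@Tr_expq _ 2 m) ?(pchar2_nat 1) // /Tr.
rewrite (big_morph (fun x : K => x ^+ 2) (id1 := 0) (op1 := +%R)).
- by apply: eq_bigr => i _; rewrite -!exprM mulnC.
- by move=> u v; rewrite exprDn_pchar ?(pchar2_nat 1).
- by rewrite expr0n.
Qed.

Lemma card_artin_schreier_im_fiber (y : K) :
  #|[set z : K | z ^+ 2 + z == y ^+ 2 + y]| = 2%N.
Proof.
have -> : [set z : K | z ^+ 2 + z == y ^+ 2 + y] = [set y; y + 1].
  by apply/setP => z; rewrite inE artin_schreier_fiber.
by rewrite cards2 -subr_eq0 opprD addrA subrr sub0r oppr_eq0 oner_eq0.
Qed.

(* The image of [y ^ 2 + y] has index 2 and lies in the kernel of the trace,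
   which is no larger: the trace is a polynomial of degree [2 ^ (m - 1)]. *)
Lemma artin_schreier_im :
  [set y ^+ 2 + y | y in [set: K]] = [set c : K | Tr 2 m c == 0].
Proof.
apply/eqP; rewrite eqEcard; apply/andP; split.
  by apply/subsetP => _ /imsetP[y _ ->]; rewrite inE Tr2_artin_schreier.
apply: leq_trans (card_Tr2_eq0 _ _ absdeg_gt0) _.
(* After doubling, the bound says that [#|K|] is at most twice the size of the image, which holds
   because every fibre has two elements. *)
rewrite -(leq_pmul2r (isT : (0 < 2)%N)) -expnSr prednK ?absdeg_gt0 // -cardK.
rewrite -cardsT -sum1_card.
rewrite (partition_big_imset (fun y : K => y ^+ 2 + y)) /= -sum_nat_const.
apply: leq_sum => _ /imsetP[y _ ->].
rewrite sum1dep_card; apply: eq_leq.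
rewrite -[RHS](card_artin_schreier_im_fiber y).
by apply: eq_card => z; rewrite !inE.
Qed.

Lemma card_artin_schreier_fiber c :
  #|[set y : K | y ^+ 2 + y == c]|%:R = 1 + chi c.
Proof.
rewrite /chi; case: ifP => [Tc|nTc].
  have: c \in [set c : K | Tr 2 m c == 0] by rewrite inE.
  by rewrite -artin_schreier_im => /imsetP[y _ ->];
    rewrite card_artin_schreier_im_fiber.
rewrite subrr (_ : [set y : K | _] = set0) ?cards0 //.
apply/setP => y; rewrite !inE; apply/eqP => yc.
by rewrite -yc Tr2_artin_schreier eqxx in nTc.
Qed.

(** For [b != 0] the cancellation comes from counting: [1 + chi c] is the number of preimages of [c]
    under [y ^+ 2 + y], so these terms add up to [#|K|] and the values of [chi] to zero. *)
Lemma sum_chi_mul b : \sum_(c : K) chi (b * c) = (#|K| * (b == 0))%:R.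
Proof.
have [->|b_neq0] := eqVneq b 0.
  under eq_bigr => c _ do rewrite mul0r chi0.
  by rewrite sumr_const muln1.
rewrite muln0 -[LHS](@reindex_inj _ _ _ _ _ xpredT chi (mulfI b_neq0)).
have sum1 : \sum_(c : K) (1 + chi c) = #|K|%:R.
  under eq_bigr => c _ do rewrite -card_artin_schreier_fiber.
  rewrite -natr_sum; congr _%:R.
  rewrite -[RHS]sum1_card.
  rewrite [RHS](partition_big (fun y : K => y ^+ 2 + y) xpredT) //=.
  by apply: eq_bigr => c _; rewrite -sum1dep_card.
move: sum1; rewrite big_split /= sumr_const => sum1.
by apply: (addrI #|K|%:R); rewrite sum1 addr0.
Qed.

End QuadraticCharacter.

(** If [iota b] is the relative trace of [c], linearity and transitivity of the trace turn the
    summand into [chi F k (b * s)], and orthogonality on [F] applies. *)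
Lemma sum_chi_subfield (F L : finFieldType) (iota : {rmorphism F -> L})
    (k n : nat) (c : L) :
  #|F| = (2 ^ k)%N -> #|L| = ((2 ^ k) ^ n)%N ->
  \sum_(s : F) chi L (k * n) (iota s * c) =
    (2 ^ k)%:R * (Tr (2 ^ k) n c == 0)%:R.
Proof.
move=> cardF cardL.
have cardL2 : #|L| = (2 ^ (k * n))%N by rewrite expnM.
have [b Tb] : exists b : F, Tr (2 ^ k) n c = iota b.
  by apply: expq_fixed_im; rewrite cardF Tr_expq // (pchar2_nat _ _ cardL2).
have TrZ s : Tr (2 ^ k) n (iota s * c) = iota s * Tr (2 ^ k) n c.
  rewrite /Tr mulr_sumr; apply: eq_bigr => i _; rewrite exprMn -rmorphXn /=.
  congr (iota _ * _); elim: (nat_of_ord i) => [|j IHj]; first exact: expr1.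
  by rewrite expnS mulnC exprM IHj -cardF expf_card.
have TrI (x : F) : Tr 2 k (iota x) = iota (Tr 2 k x).
  by rewrite /Tr rmorph_sum; apply: eq_bigr => i _; rewrite rmorphXn.
transitivity (\sum_(s : F) chi F k (b * s)).
  apply: eq_bigr => s _.
  rewrite /chi Tr_transitive ?(pchar2_nat _ _ cardL2 1) //.
  by rewrite TrZ Tb -rmorphM TrI fmorph_eq0 mulrC.
by rewrite (sum_chi_mul _ _ cardF) cardF natrM Tb fmorph_eq0.
Qed.

(** * Points of the projective cubic *)

Section CubicPoints.

Variable L : finFieldType.
Implicit Types (v w : 'rV[L]_3) (x y z c : L).

Definition vec3 x y z : 'rV[L]_3 := \row_(j < 3) [:: x; y; z]`_j.

Lemma vec3_0 x y z : vec3 x y z 0 (inord 0) = x.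
Proof. by rewrite mxE inordK. Qed.

Lemma vec3_1 x y z : vec3 x y z 0 (inord 1) = y.
Proof. by rewrite mxE inordK. Qed.

Lemma vec3_2 x y z : vec3 x y z 0 (inord 2) = z.
Proof. by rewrite mxE inordK. Qed.

Lemma vec3_eta v :
  v = vec3 (v 0 (inord 0)) (v 0 (inord 1)) (v 0 (inord 2)).
Proof.
apply/rowP => j; rewrite mxE.
by case: j => [[|[|[|j]]] Hj] //=; congr (v _ _);
  apply/val_inj; rewrite /= inordK.
Qed.

Lemma vec3_inj x y z x' y' z' :
  vec3 x y z = vec3 x' y' z' -> [/\ x = x', y = y' & z = z'].
Proof.
move=> eq_v; split.
- by rewrite -[LHS](vec3_0 x y z) eq_v vec3_0.
- by rewrite -[LHS](vec3_1 x y z) eq_v vec3_1.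
- by rewrite -[LHS](vec3_2 x y z) eq_v vec3_2.
Qed.

Lemma vec3Z c x y z : c *: vec3 x y z = vec3 (c * x) (c * y) (c * z).
Proof. by apply/rowP => j; rewrite !mxE; case: j => [[|[|[|j]]] Hj]. Qed.

Lemma vec3_eq0 x y z : (vec3 x y z == 0) = [&& x == 0, y == 0 & z == 0].
Proof.
have <- : vec3 0 0 0 = 0.
  by apply/rowP => j; rewrite !mxE; case: j => [[|[|[|j]]] Hj].
apply/eqP/and3P => [/vec3_inj[-> -> ->]|[/eqP-> /eqP-> /eqP->]] //.
Qed.

(** Written exactly as a block of [equivalence_partition], so that membership of a class in
    [proj_plane] is immediate. *)
Definition proj_class v : {set 'rV[L]_3} :=
  [set w in [set v : 'rV[L]_3 | v != 0] | proportional v w].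

Lemma proj_classZ c v : c != 0 -> proj_class (c *: v) = proj_class v.
Proof.
move=> c_neq0; apply/setP => w; rewrite !inE; congr (_ && _).
apply/existsP/existsP => -[d /andP[d_neq0 /eqP ->]].
  by exists (d * c); rewrite mulf_neq0 //= scalerA.
by exists (d / c); rewrite mulf_neq0 ?invr_eq0 //= scalerA divfK.
Qed.

Lemma proj_class_eq v w :
  w != 0 -> proj_class v = proj_class w -> exists2 c, c != 0 & w = c *: v.
Proof.
move=> w_neq0 eq_vw; have: w \in proj_class w.
  rewrite !inE w_neq0; apply/existsP; exists 1.
  by rewrite oner_eq0 scale1r eqxx.
by rewrite -eq_vw !inE => /andP[_ /existsP[c /andP[c_neq0 /eqP ->]]]; exists c.
Qed.

Lemma on_cubicZ alpha c v :
  c != 0 -> on_cubic alpha (c *: v) = on_cubic alpha v.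
Proof.
move=> c_neq0; rewrite /on_cubic !mxE.
set x := v 0 _; set y := v 0 _; set z := v 0 _.
rewrite -subr_eq0 -[RHS]subr_eq0.
have -> : c * x * (c * y) ^+ 2 + c * x * (c * y) * (c * z) -
    alpha * ((c * x) ^+ 2 * (c * z) + (c * z) ^+ 3) =
    c ^+ 3 * (x * y ^+ 2 + x * y * z - alpha * (x ^+ 2 * z + z ^+ 3)) by ring.
by rewrite mulf_eq0 expf_eq0 (negPf c_neq0).
Qed.

Lemma mem_curve_points alpha v :
  v != 0 -> (proj_class v \in curve_points alpha) = on_cubic alpha v.
Proof.
move=> v_neq0; rewrite inE.
have -> /= : proj_class v \in proj_plane L.
  by apply/imsetP; exists v; rewrite ?inE.
apply/forall_inP/idP => [|Cv w]; first apply.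
  rewrite !inE v_neq0; apply/existsP; exists 1.
  by rewrite oner_eq0 scale1r eqxx.
by rewrite !inE => /andP[_ /existsP[c /andP[c_neq0 /eqP ->]]];
  rewrite on_cubicZ.
Qed.

Definition affine_points alpha : {set L * L} :=
  [set p | p.1 * (p.2 ^+ 2 + p.2) == alpha * (p.1 ^+ 2 + 1)].

(** At [z = 0] the equation reduces to [x * y ^+ 2 = 0], which leaves two points at infinity; any
    other point can be scaled to [z = 1]. *)
Lemma curve_pointsE alpha :
  curve_points alpha =
    proj_class (vec3 1 0 0) |: (proj_class (vec3 0 1 0) |:
      [set proj_class (vec3 p.1 p.2 1) | p in affine_points alpha]).
Proof.
have affE x y : on_cubic alpha (vec3 x y 1) = ((x, y) \in affine_points alpha).
  rewrite inE /on_cubic vec3_0 vec3_1 vec3_2 /=.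
  by rewrite !mulr1 expr1n (mulrDr x).
have infE x y : on_cubic alpha (vec3 x y 0) = (x == 0) || (y == 0).
  rewrite /on_cubic vec3_0 vec3_1 vec3_2 !mulr0 expr0n /= !addr0 mulr0.
  by rewrite mulf_eq0 expf_eq0.
apply/setP => P; apply/idP/idP => [PC|].
  have [v v_neq0 eqP] : exists2 v, v != 0 & P = proj_class v.
    move: PC; rewrite inE => /andP[/imsetP[v]]; rewrite inE => v_neq0 -> _.
    by exists v.
  move: PC v_neq0; rewrite {P}eqP => PC v_neq0; move: PC.
  rewrite mem_curve_points //.
  rewrite (vec3_eta v) in v_neq0 *.
  move: v_neq0; set x := v 0 _; set y := v 0 _; set z := v 0 _ => v_neq0.
  have [z0|z_neq0] := eqVneq z 0.
    move: v_neq0; rewrite z0 infE vec3_eq0 eqxx andbT => v_neq0 /orP[] /eqP u0.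
      move: v_neq0; rewrite u0 eqxx /= => y_neq0.
      rewrite -[vec3 0 y 0](_ : y *: vec3 0 1 0 = _).
        by rewrite proj_classZ // !inE eqxx orbT.
      by rewrite vec3Z !mulr0 mulr1.
    move: v_neq0; rewrite u0 eqxx andbT => x_neq0.
    rewrite -[vec3 x 0 0](_ : x *: vec3 1 0 0 = _) ?proj_classZ ?inE ?eqxx //.
    by rewrite vec3Z !mulr0 mulr1.
  rewrite -[vec3 x y z](_ : z *: vec3 (x / z) (y / z) 1 = _); last first.
    by rewrite vec3Z mulr1 ![z * _]mulrC !divfK.
  rewrite on_cubicZ // affE => Axy; rewrite proj_classZ // !inE.
  by apply/orP; right; apply/orP; right; apply/imsetP; exists (x / z, y / z).
case/setU1P => [->|/setU1P[->|/imsetP[[x y] Axy ->]]] /=;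
  rewrite mem_curve_points ?vec3_eq0 ?oner_eq0 ?andbF ?infE ?eqxx ?orbT //.
by rewrite affE.
Qed.

(** Comparing last coordinates separates infinity from the affine chart, and forces the scalar
    between two affine representatives to be 1. *)
Lemma card_curve_points alpha :
  #|curve_points alpha| = (2 + #|affine_points alpha|)%N.
Proof.
have nz1 x y : vec3 x y 1 != 0 by rewrite vec3_eq0 oner_eq0 !andbF.
have contra1 x y x' y' :
    proj_class (vec3 x y 0) = proj_class (vec3 x' y' 1) -> False.
  case/(proj_class_eq _ _ (nz1 _ _)) => c _; rewrite vec3Z mulr0.
  by case/vec3_inj => _ _ /eqP; rewrite oner_eq0.
rewrite curve_pointsE !cardsU1 card_in_imset; last first.
  move=> [x y] [x' y'] _ _ /= /(proj_class_eq _ _ (nz1 _ _))[c _].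
  by rewrite vec3Z mulr1 => /vec3_inj[-> -> <-]; rewrite !mul1r.
rewrite (_ : _ \in _ = false); last first.
  apply/negP; rewrite !inE => /orP[/eqP|/imsetP[[x y] _]]; last exact: contra1.
  case/proj_class_eq => [|c _]; first by rewrite vec3_eq0 oner_eq0 andbF.
  rewrite vec3Z mulr0 => /vec3_inj[_ /eqP].
  by rewrite oner_eq0.
rewrite (_ : _ \in _ = false) ?addnA //.
by apply/negP => /imsetP[[x y] _]; exact: contra1.
Qed.

(** No point has [x = 0], since [alpha != 0]; for other [x], division by [x] gives an Artin-Schreier
    equation in [y]. *)
Lemma card_affine_points m alpha :
  #|L| = (2 ^ m)%N -> alpha != 0 ->
  #|affine_points alpha|%:R =
    \sum_(x : L | x != 0) (1 + chi L m (alpha * x + alpha * x^-1)).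
Proof.
move=> cardL alpha_neq0.
rewrite -sum1_card (partition_big (fun p : L * L => p.1) xpredT) //=.
rewrite (bigD1 0) //= big1 ?add0n => [|[x y]]; last first.
  rewrite inE /= => /andP[+ /eqP x0]; rewrite x0 mul0r expr0n add0r mulr1.
  by rewrite eq_sym (negPf alpha_neq0).
rewrite natr_sum; apply: eq_bigr => x x_neq0.
rewrite -(card_artin_schreier_fiber _ _ cardL); congr _%:R.
rewrite sum1dep_card -(card_imset _ (can_inj (fun y => erefl : (x, y).2 = y))).
apply: eq_card => -[x' y]; rewrite !inE /=.
have eq_y : (x * (y ^+ 2 + y) == alpha * (x ^+ 2 + 1)) =
            (y ^+ 2 + y == alpha * x + alpha / x).
  rewrite -(inj_eq (mulfI x_neq0) (y ^+ 2 + y)); congr (_ == _).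
  by field.
apply/andP/imsetP => [[Axy /eqP x'x]|[y' + [-> yy']]].
  by exists y; rewrite ?x'x // inE -eq_y; rewrite x'x in Axy.
by rewrite -yy' inE -eq_y.
Qed.

End CubicPoints.

(** As [0^-1 = 0], the term [a = 0] contributes 1: this is the classical sum over nonzero [a], plus
    1. *)
Definition kloosterman_sum (L : finFieldType) (m : nat) (s t : L) : rat :=
  \sum_(a : L) chi L m (s * a + t * a^-1).

(** * Evaluation of Kloosterman sums and their link with the cubic *)

Section KloostermanSums.

Variables (L : finFieldType) (m : nat).
Hypothesis cardL : #|L| = (2 ^ m)%N.

Lemma kloosterman_sumr0 (s : L) :
  kloosterman_sum L m s 0 = (#|L| * (s == 0))%:R.
Proof.
rewrite -(sum_chi_mul _ _ cardL s); apply: eq_bigr => a _.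
by rewrite mul0r addr0.
Qed.

Lemma kloosterman_sum0r (t : L) :
  kloosterman_sum L m 0 t = (#|L| * (t == 0))%:R.
Proof.
rewrite -(sum_chi_mul _ _ cardL t) [RHS](reindex_inj invr_inj) /=.
by apply: eq_bigr => a _; rewrite mul0r add0r.
Qed.

(** Substitute [s * a] for [a] in the right-hand sum. *)
Lemma kloosterman_sum_mul (s t : L) :
  s != 0 -> kloosterman_sum L m s t = kloosterman_sum L m 1 (s * t).
Proof.
move=> s_neq0; rewrite [RHS](reindex_inj (mulfI s_neq0)) /=.
apply: eq_bigr => a _; congr (chi _ _ (_ + _)); first by rewrite mul1r.
by rewrite invfM mulrACA divff // mul1r.
Qed.

(** The count is [2 + (#|L| - 1) + (K - 1)]: points at infinity, the constants 1 over [x != 0], and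
    the Kloosterman sum [K] without its term at 0. *)
Lemma card_curve_kloosterman (alpha : L) :
  alpha != 0 ->
  #|curve_points alpha|%:R = #|L|%:R + kloosterman_sum L m alpha alpha.
Proof.
move=> alpha_neq0; rewrite card_curve_points natrD.
rewrite (card_affine_points _ _ _ cardL) // /kloosterman_sum.
rewrite [X in _ = _ + X](bigD1 0) //= big_split /= mulr0 invr0 mulr0 addr0 chi0.
rewrite sumr_const (_ : #|_| = #|L|.-1); last first.
  by rewrite -[in RHS](cardC1 (0 : L)); apply: eq_card.
rewrite -[in RHS](@prednK #|L|); last exact: ltnW (finNzRing_gt1 L).
by rewrite -[in RHS]natr1; ring.
Qed.

End KloostermanSums.

Theorem theorem2 (q n : nat) (F L : finFieldType)
    (iota : {rmorphism F -> L})
    (hq : exists k : nat, q = (2 ^ k)%N)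
    (hn : (1 <= n)%N)
    (cardF : #|F| = q)
    (cardL : #|L| = (q ^ n)%N) :
  (Fcount L q n)%:R =
    (q%:R : rat) ^ (n%:Z - 2) +
    ((q%:R - 1) / q%:R ^+ 2) *
      \sum_(alpha : F | alpha != 0) ((S_curve iota alpha)%:~R + 1).
Proof.
case: hq => k def_q; rewrite {q}def_q in cardF cardL *.
set q := (2 ^ k)%N.
have cardL2 : #|L| = (2 ^ (k * n))%N by rewrite expnM.
have q_neq0 : q%:R != 0 :> rat by rewrite pnatr_eq0 expn_eq0.
pose K (s t : F) := kloosterman_sum L (k * n) (iota s) (iota t).
have -> : \sum_(alpha : F | alpha != 0) ((S_curve iota alpha)%:~R + 1) =
    \sum_(alpha : F | alpha != 0) K alpha alpha.
  apply: eq_bigr => alpha alpha_neq0.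
  rewrite /S_curve rmorphB rmorphD /= -!pmulrn.
  rewrite (card_curve_kloosterman _ _ cardL2) ?fmorph_eq0 //.
  by rewrite /K; ring.
have count : q%:R ^+ 2 * (Fcount L q n)%:R = \sum_(s : F) \sum_(t : F) K s t.
  (* For fixed [a] the double sum factors into two orthogonality sums: it is [q ^ 2] if both traces
     vanish and 0 otherwise. *)
  transitivity (\sum_(a : L) \sum_(s : F) \sum_(t : F)
      chi L (k * n) (iota s * a) * chi L (k * n) (iota t * a^-1)).
    rewrite /Fcount -sum1_card natr_sum mulr_sumr big_mkcond /=.
    apply: eq_bigr => a _; rewrite inE.
    under eq_bigr => s _ do rewrite -mulr_sumr.
    rewrite -mulr_suml !(sum_chi_subfield _ _ _ _ _ _ cardF cardL).
    (* This includes [a = 0], in agreement with the convention [rTr(0) = 0]. *)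
    have -> : rTr q n a = Tr q n a^-1.
      by apply: eq_bigr => i _; rewrite exprVn.
    rewrite -/q; case: (Tr q n a == 0); case: (Tr q n a^-1 == 0);
      by rewrite /= ?mulr1 ?mulr0 ?mul0r // expr2.
  rewrite exchange_big; apply: eq_bigr => s _.
  rewrite exchange_big; apply: eq_bigr => t _.
  by apply: eq_bigr => a _; rewrite (chiD _ _ cardL2).
have K1 s t : s != 0 -> K s t = K 1 (s * t).
  move=> s_neq0; rewrite /K kloosterman_sum_mul ?fmorph_eq0 //.
  by rewrite rmorph1 rmorphM.
have sum_K1 s : s != 0 ->
    \sum_(t : F | t != 0) K s t = \sum_(alpha : F | alpha != 0) K alpha alpha.
  move=> s_neq0.
  transitivity (\sum_(t : F | t != 0) K 1 t).
    rewrite [RHS](reindex_inj (mulfI s_neq0)) /=.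
    apply: eq_big => [t|t _]; last exact: K1.
    by rewrite mulf_eq0 (negPf s_neq0).
  (* Squaring is the Frobenius map of [F], so [t] may be replaced by [t ^+ 2], and
     [K 1 (t * t) = K t t]. *)
  have sqr_inj : injective (fun x : F => x ^+ 2).
    exact: (fmorph_inj (pFrobenius_aut (pchar2 _ _ cardF))).
  rewrite (reindex_inj sqr_inj) /=.
  by apply: eq_big => [t|t]; rewrite expf_eq0 //= => t_neq0; rewrite [RHS]K1.
have sum_K : \sum_(s : F) \sum_(t : F) K s t =
    q%:R ^+ n + (q%:R - 1) * \sum_(alpha : F | alpha != 0) K alpha alpha.
  (* Row [s = 0] contributes only [K 0 0 = q ^ n]. In each of the other [q - 1] rows the term
     [t = 0] vanishes and the rest is the same sum. *)
  rewrite (bigD1 0) //= (bigD1 0) //= big1 => [|t t_neq0]; last first.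
    rewrite /K rmorph0 (kloosterman_sum0r _ _ cardL2) fmorph_eq0.
    by rewrite (negPf t_neq0) muln0.
  rewrite addr0 {1}/K rmorph0 (kloosterman_sumr0 _ _ cardL2) eqxx muln1.
  rewrite cardL natrX.
  congr (_ + _).
  transitivity (\sum_(s : F | s != 0)
                  \sum_(alpha : F | alpha != 0) K alpha alpha).
    apply: eq_bigr => s s_neq0; rewrite (bigD1 0) //= sum_K1 //.
    rewrite {1}/K rmorph0 (kloosterman_sumr0 _ _ cardL2) fmorph_eq0.
    by rewrite (negPf s_neq0) muln0 add0r.
  rewrite sumr_const -[LHS]mulr_natl; congr (_ * _).
  rewrite (_ : #|_| = #|F|.-1); last first.
    by rewrite -[in RHS](cardC1 (0 : F)); apply: eq_card.
  by rewrite cardF -subn1 natrB // expn_gt0.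
(* The exponent is an integer, negative when [n = 1]; splitting it uses [q_neq0]. *)
have -> : (q%:R : rat) ^ (n%:Z - 2) = q%:R ^+ n / q%:R ^+ 2.
  by rewrite expfzDr.
apply: (mulfI (expf_neq0 2 q_neq0)); rewrite count sum_K.
by field.
Qed.
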